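(* Let $\pi\colon X\to Y$ be a finite abelian cover between compact complex manifolds with Galois group $G$, let $m\ge1$ with $H^0(X,K_X^{\otimes m})\ne0$, and let $y\in Y$ be general. Then the map $$\mathbb{P}(\epsilon_y^\vee)\colon G\to\mathbb{P}\big(H^0(X,K_X^{\otimes m})^\vee\big),\qquad g\mapsto[\operatorname{ev}_{g(x_0)}],$$ is injective if and only if for every $h\in G\setminus\{1_G\}$ there exist irreducible constituents $\chi,\chi'$ of the character $\chi_m$ of the $m$-canonical representation $\rho_m$ such that $\chi(h)\ne\chi'(h)$.
   Context: A finite abelian cover $\pi\colon X\to Y$ with Galois group $G$ is a finite morphism which is the quotient by a faithful action of the finite abelian group $G$ on $X$; $X$ and $Y$ are connected. The $m$-canonical representation is $\rho_m\colon G\to\operatorname{GL}(H^0(X,K_X^{\otimes m}))$, $\rho_m(g)(\omega)=g^*\omega$, with character $\chi_m$. For $\chi\in\operatorname{Irr}(G)$, $(\pi_*K_X^{\otimes m})^\chi$ is the line bundle on $Y$ whose sections over $U$ are the $\omega\in K_X^{\otimes m}(\pi^{-1}(U))$ with $g^*\omega=\chi(g)\omega$ for all $g\in G$. ''$y$ general'' means: $y$ lies outside the branch locus of $\pi$ and outside the base loci of the line bundles $(\pi_*K_X^{\otimes m})^\chi$ for all irreducible constituents $\chi$ of $\chi_m$. Evaluation: fix $x_0\in\pi^{-1}(y)$; then $g\mapsto g(x_0)$ is a bijection $G\to\pi^{-1}(y)$. Choose an open neighbourhood $U_{x_0}$ of $x_0$ mapping biholomorphically onto an open neighbourhood $W_y$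 of $y$ with $\pi^{-1}(W_y)=\bigsqcup_{g\in G}g(U_{x_0})$, and a chart $\varphi\colon U_{x_0}\to B_\sigma(0)\subset\mathbb{C}^n$ with $\varphi(x_0)=0$. For $\omega\in H^0(X,K_X^{\otimes m})$ and $g\in G$ write $(g\circ\varphi^{-1})^*\omega=f_{g,\omega}\,(dz_1\wedge\dots\wedge dz_n)^{\otimes m}$ with $f_{g,\omega}$ holomorphic on $B_\sigma(0)$, and set $\operatorname{ev}_{g(x_0)}(\omega):=f_{g,\omega}(0)$. The notation $\epsilon_y^\vee$ refers to the dual of $\epsilon_y\colon H^0(X,K_X^{\otimes m})\to\mathbb{C}[G]$, $\omega\mapsto\sum_{g\in G}\operatorname{ev}_{g(x_0)}(\omega)\,g^{-1}$; the map $\mathbb{P}(\epsilon_y^\vee)$ is the one displayed in the claim, and it is the restriction of the $m$-canonical map of $X$ to the fibre $\pi^{-1}(y)\cong G$. *)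

(* Defs.v *)
(* The complex numbers are R[i] for an arbitrary realType R, and C^n is the
   normed R[i]-module 'rV[R[i]]_n, so that differentiable, 'D_v and 'J below are
   complex differentiability, complex derivatives and complex Jacobians. *)
From HB Require Import structures.
From mathcomp Require Import all_boot all_order all_algebra all_fingroup.
From mathcomp Require Import all_character.
From mathcomp Require Import complex.
From mathcomp Require Import all_classical all_reals all_analysis.

Set Implicit Arguments.
Unset Strict Implicit.
Unset Printing Implicit Defensive.

Import Order.TTheory GRing.Theory Num.Theory.
Import numFieldNormedType.Exports.

Local Open Scope classical_set_scope.
Local Open Scope ring_scope.

(* Gives R[i], hence 'rV[R[i]]_n, its usual topology. *)
HB.instance Definition _ (R : realType) := NormedModule.copy R[i] R[i]^o.

Section Holomorphic.
Context {K : numFieldType} {V W : normedModType K}.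

Fixpoint Cdifferentiable (k : nat) (U : set V) (f : V -> W) : Prop :=
  if k is k'.+1 then
    (forall z, U z -> differentiable f z) /\
    (forall v, Cdifferentiable k' U (fun z => 'D_v f z))
  else True.

(* Holomorphic functions are taken to be the smooth functions with complex-
   linear derivative: f is complex differentiable on U, as are its directional
   derivatives of every order.  (By Goursat and Osgood, complex
   differentiability on the open set U implies the rest.) *)
Definition holomorphic (U : set V) (f : V -> W) : Prop :=
  forall k, Cdifferentiable k U f.

Lemma near_eq_differentiable (f g : V -> W) (x : V) :
  (\forall z \near x, f z = g z) -> differentiable f x -> differentiable g x.
Proof.
move=> fg df; apply/diff_locallyP.
have dg : g \o shift x = cst (g x) + 'd f x +o_ 0 id.
  apply/eqaddoP => e e0.
  have /eqaddoP/(_ e e0) h := diff_locally df.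
  have fg0 : \forall z \near (0 : V), f (z + x) = g (z + x).
    by move: fg; rewrite (near_shift 0 x) subr0.
  near=> z.
  have <- : (f \o shift x - (cst (f x) + 'd f x)) z =
            (g \o shift x - (cst (g x) + 'd f x)) z.
    rewrite -[LHS]/(f (z + x) - (f x + 'd f x z)).
    rewrite -[RHS]/(g (z + x) - (g x + 'd f x z)) (nbhs_singleton fg).
    by congr (_ - _); near: z.
  by near: z.
have dlin : continuous ('d f x) by exact: diff_continuous.
by have -> : 'd g x = 'd f x :> (V -> W) by exact: diff_unique.
Unshelve. all: by end_near. Qed.

Lemma eq_Cdifferentiable k (U : set V) (f g : V -> W) : open U ->
  (forall z, U z -> f z = g z) -> Cdifferentiable k U f -> Cdifferentiable k U g.
Proof.
move=> oU; elim: k f g => //= k IHk f g fg [df dDf].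
have nfg z : U z -> \forall z' \near z, f z' = g z'.
  by move=> Uz; apply: filterS fg _; exact: open_nbhs_nbhs.
split=> [z Uz|v]; first exact: near_eq_differentiable (nfg z Uz) (df z Uz).
by apply: IHk (dDf v) => z Uz; exact/near_eq_derive/nfg.
Qed.

Lemma eq_holomorphic (U : set V) (f g : V -> W) : open U ->
  (forall z, U z -> f z = g z) -> holomorphic U f -> holomorphic U g.
Proof. by move=> oU fg hf k; exact: eq_Cdifferentiable oU fg (hf k). Qed.

Lemma holomorphic_differentiable (U : set V) (f : V -> W) z :
  holomorphic U f -> U z -> differentiable f z.
Proof. by move=> /(_ 1) [df _]; exact: df. Qed.

Lemma holomorphic_sub (U U' : set V) (f : V -> W) :
  U' `<=` U -> holomorphic U f -> holomorphic U' f.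
Proof.
move=> sU hf k; elim: k f {hf}(hf k) => //= k IHk f [df dDf].
by split=> [z /sU /df //|v]; exact: IHk.
Qed.

Lemma holomorphic0 (U : set V) : holomorphic U (fun _ => 0 : W).
Proof.
move=> k; elim: k => //= k IHk; split=> [z _|v]; first exact: differentiable_cst.
by rewrite (_ : (fun z => _) = (fun=> 0)) //; apply/funext => z; rewrite derive_cst.
Qed.

Lemma holomorphic_lin (U : set V) (f g : V -> W) (c : K) : open U ->
  holomorphic U f -> holomorphic U g -> holomorphic U (fun z => c *: f z + g z).
Proof.
move=> oU hf hg k; elim: k f g {hf hg}(hf k) (hg k) => //= k IHk f g.
move=> [df dDf] [dg dDg]; split=> [z Uz|v].
  change (differentiable (c *: f + g) z).
  by apply: differentiableD (dg z Uz); exact: differentiableZ (df z Uz).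
apply: eq_Cdifferentiable (IHk _ _ (dDf v) (dDg v)) => // z Uz.
rewrite -[RHS]/('D_v (c *: f + g) z) deriveD ?deriveZ //.
- exact: diff_derivable (df z Uz).
- exact: derivableZ (diff_derivable (df z Uz)).
- exact: diff_derivable (dg z Uz).
Qed.

End Holomorphic.

Section Manifolds.
Variables (R : realType) (n : nat).
Local Notation C := R[i].

Record chart (X : topologicalType) := Chart {
  dom : set X;
  coord : X -> 'rV[C]_n;
  param : 'rV[C]_n -> X;
  open_dom : open dom;
  open_img : open (coord @` dom);
  coordK : forall x, dom x -> param (coord x) = x;
  coord_continuous : forall x, dom x -> {for x, continuous coord};
  param_continuous : forall z, (coord @` dom) z -> {for z, continuous param} }.

Definition transition_holomorphic (X : topologicalType) (a b : chart X) : Prop :=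
  holomorphic (coord a @` (dom a `&` dom b)) (coord b \o param a).

(* The atlas is the maximal one, so it contains every holomorphic chart. *)
Record cmanifold := CManifold {
  space :> topologicalType;
  atlas : set (chart space);
  manifold_hausdorff : hausdorff_space space;
  manifold_second_countable : @second_countable space;
  atlas_cover : forall x : space, exists a : chart space, atlas a /\ dom a x;
  atlas_compat : forall a b, atlas a -> atlas b -> transition_holomorphic a b;
  atlas_max : forall c,
    (forall a, atlas a -> transition_holomorphic a c /\ transition_holomorphic c a) ->
    atlas c }.

Definition chart_at (X : cmanifold) (x : X) : chart X := sval (cid (atlas_cover x)).

End Manifolds.

Section Maps.
Variables (R : realType) (n : nat).
Local Notation C := R[i].
Implicit Types X Y Z : cmanifold R n.

Definition holomorphic_map_on X Y (U : set X) (F : X -> Y) : Prop :=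
  (forall x, U x -> {for x, continuous F}) /\
  (forall a b, atlas a -> atlas b ->
     holomorphic (coord a @` (U `&` dom a `&` F @^-1` dom b))
                 (coord b \o F \o param a)).

Definition holomorphic_map X Y (F : X -> Y) : Prop := holomorphic_map_on setT F.

Definition holomorphic_fun_on X (U : set X) (f : X -> C) : Prop :=
  forall a, atlas a ->
    holomorphic (coord a @` (U `&` dom a)) (f \o param a : 'rV[C]_n -> C^o).

Definition biholomorphic_onto X Y (U : set X) (W : set Y) (F : X -> Y) : Prop :=
  [/\ open U, open W, holomorphic_map_on U F &
      exists F' : Y -> X, [/\ holomorphic_map_on W F',
        forall x, U x -> W (F x) /\ F' (F x) = x &
        forall y, W y -> U (F' y) /\ F (F' y) = y]].

Definition branch_locus X Y (pi : X -> Y) : set Y :=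
  pi @` [set x | ~ exists U W, U x /\ biholomorphic_onto U W pi].

Definition finite_morphism X Y (pi : X -> Y) : Prop :=
  [/\ holomorphic_map pi,
      forall A : set X, closed A -> closed (pi @` A) &
      forall y, finite_set (pi @^-1` [set y])].

Record holomorphic_action X (gT : finGroupType) (act : gT -> X -> X) : Prop := {
  act1 : forall x, act 1%g x = x;
  actM : forall g h x, act (g * h)%g x = act g (act h x);
  act_holomorphic : forall g, holomorphic_map (act g) }.

(* Y is the quotient of X by the action as a ringed space: its points are the
   orbits, its topology is the quotient topology, and its holomorphic functions
   are the invariant holomorphic functions of X. *)
Record is_quotient X Y (gT : finGroupType) (act : gT -> X -> X) (pi : X -> Y)
    : Prop := {
  quotient_surj : forall y, exists x, pi x = y;
  quotient_orbit : forall x x', pi x = pi x' <-> exists g, x' = act g x;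
  quotient_open : forall V : set Y, open (pi @^-1` V) <-> open V;
  quotient_fun : forall (V : set Y) (f : Y -> C), open V ->
    holomorphic_fun_on (pi @^-1` V) (f \o pi) <-> holomorphic_fun_on V f }.

Record abelian_cover X Y (gT : finGroupType) (act : gT -> X -> X) (pi : X -> Y)
    : Prop := {
  cover_connected_src : connected [set: X];
  cover_connected_tgt : connected [set: Y];
  cover_abelian : abelian [set: gT]%SET;
  cover_action :> holomorphic_action act;
  cover_faithful : forall g, (forall x, act g x = x) -> g = 1%g;
  cover_finite : finite_morphism pi;
  cover_quotient : is_quotient act pi }.

End Maps.

Section Pluriforms.
Variables (R : realType) (n : nat) (X : cmanifold R n) (m : nat).
Local Notation C := R[i].

(* A section of the m-th power of the canonical bundle is encoded by its
   coefficients: w x a is the coefficient, at the point x, of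
   (dz_1 /\ ... /\ dz_n)^m in the chart a.  The coefficient is 0 by convention
   where it makes no sense. *)
Definition preform := X -> chart R n X -> C^o.

Record is_pluriform (U : set X) (w : preform) : Prop := IsPluriform {
  pluriform_support : forall x a, ~ [/\ U x, atlas a & dom a x] -> w x a = 0;
  pluriform_cocycle : forall x a b,
    U x -> atlas a -> atlas b -> dom a x -> dom b x ->
    w x a = w x b * \det ('J (coord b \o param a) (coord a x)) ^+ m;
  pluriform_holomorphic : forall a, atlas a ->
    holomorphic (coord a @` (U `&` dom a)) (fun z => w (param a z) a) }.

Lemma chart_at_atlas (x : X) : atlas (chart_at x).
Proof. by rewrite /chart_at; case: cid => a []. Qed.

Lemma dom_chart_at (x : X) : dom (chart_at x) x.
Proof. by rewrite /chart_at; case: cid => a []. Qed.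

Lemma open_chart_img (a : chart R n X) (U : set X) :
  open U -> open (coord a @` (U `&` dom a)).
Proof.
move=> oU; rewrite openE => _ [x [Ux ax] <-].
have nimg : \forall z \near coord a x, (coord a @` dom a) z.
  by apply: open_nbhs_nbhs; split; [exact: open_img | exists x].
have cp : {for coord a x, continuous (param a)}.
  by apply: param_continuous; exists x.
have nU : \forall z \near coord a x, U (param a z).
  by apply: cp; rewrite coordK //; exact: open_nbhs_nbhs.
apply: filterS2 nimg nU => _ [x' ax' <-]; rewrite coordK // => Ux'.
by exists x'.
Qed.

Definition pluriform_pred (U : set X) : {pred preform} :=
  fun w => `[< is_pluriform U w >].

End Pluriforms.

Section PluriformSpace.
Variables (R : realType) (n : nat) (X : cmanifold R n) (m : nat).
Local Notation C := R[i].

Lemma pluriform_submod_closed : submod_closed (pluriform_pred (X := X) m setT).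
Proof.
split=> [|c v w /asboolP[sv cv hv] /asboolP[sw cw hw]]; apply/asboolP; split.
- by [].
- by move=> x a b *; rewrite mul0r.
- by move=> a aa; exact: holomorphic0.
- by move=> x a nxa; rewrite !fctE sv // sw // scaler0 addr0.
- move=> x a b xT aa ab xa xb.
  rewrite -[LHS]/(c * v x a + w x a) -[in RHS]/(c * v x b + w x b).
  by rewrite (cv x a b) // (cw x a b) // mulrA -mulrDl.
- move=> a aa; apply: holomorphic_lin (hv a aa) (hw a aa).
  exact/open_chart_img/openT.
Qed.

HB.instance Definition _ :=
  GRing.isSubmodClosed.Build C (preform X) (pluriform_pred m setT)
    pluriform_submod_closed.

(* H^0(X, K_X^m) *)
Record pluriform : Type :=
  Pluriform { form_val :> preform X; _ : form_val \in pluriform_pred m setT }.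

HB.instance Definition _ := [isSub for form_val].
HB.instance Definition _ := [Choice of pluriform by <:].
HB.instance Definition _ := [SubChoice_isSubLmodule of pluriform by <:].

End PluriformSpace.

Section Pullback.
Variables (R : realType) (n : nat) (X : cmanifold R n) (m : nat).
Local Notation C := R[i].

(* The function f with F^* w = f (dz_1 /\ ... /\ dz_n)^m, for F a map to X
   defined on an open subset of C^n. *)
Definition pullback_coef (w : preform X) (F : 'rV[C]_n -> X) (z : 'rV[C]_n) : C :=
  w (F z) (chart_at (F z)) * \det ('J (coord (chart_at (F z)) \o F) z) ^+ m.

Definition pullback (F : X -> X) (w : preform X) : preform X := fun x a =>
  if `[< atlas a /\ dom a x >] then pullback_coef w (F \o param a) (coord a x)
  else 0.

End Pullback.

Section Jacobian.
Variables (K : numFieldType) (n : nat).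
Implicit Types f g : 'rV[K]_n -> 'rV[K]_n.

Lemma mul_jacobian (v : 'rV[K]_n) f z : v *m 'J f z = 'd f z v.
Proof. exact: mul_rV_lin1. Qed.

Lemma jacobian_comp f g z : differentiable f z -> differentiable g (f z) ->
  'J (g \o f) z = 'J f z *m 'J g (f z).
Proof.
move=> df dg; apply/row_matrixP => i; rewrite !rowE mulmxA.
transitivity ('d (g \o f) z 'e_i); first exact: mul_jacobian.
transitivity ('d f z 'e_i *m 'J g (f z)).
  apply: etrans (congr1 (@^~ 'e_i) (diff_comp df dg)) _; apply/esym.
  exact: (mul_jacobian ('d f z 'e_i) g).
by congr (_ *m _); apply/esym; exact: mul_jacobian.
Qed.

Lemma near_eq_jacobian f g z : (\forall z' \near z, f z' = g z') ->
  differentiable f z -> 'J f z = 'J g z.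
Proof.
move=> fg df; have dg := near_eq_differentiable fg df.
have E v : 'd f z v = 'd g z v.
  apply: etrans (esym (deriveE v df)) _; apply: etrans _ (deriveE v dg).
  exact: near_eq_derive.
apply/row_matrixP => i; rewrite [LHS]rowE [RHS]rowE.
apply: etrans (mul_jacobian _ f z) _; apply: etrans (E _) _; apply/esym.
exact: mul_jacobian.
Qed.

Lemma jacobian_id (z : 'rV[K]_n) : 'J (@id 'rV[K]_n) z = 1%:M.
Proof.
have E := @diff_val _ _ _ _ _ _ _ (is_diff_id z).
apply/row_matrixP => i; rewrite [LHS]rowE [RHS]rowE mulmx1.
apply: etrans (mul_jacobian _ id z) _.
by have /= := congr1 (fun h : 'rV[K]_n -> 'rV[K]_n => h 'e_i) E; apply.
Qed.

End Jacobian.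

Section ChainRule.
Variables (R : realType) (n : nat).
Local Notation C := R[i].
Implicit Types X Y Z : cmanifold R n.

Lemma near_param X (a : chart R n X) (P : set X) x : dom a x ->
  (\forall x' \near x, P x') -> \forall z \near coord a x, P (param a z).
Proof.
move=> ax Px; have : {for coord a x, continuous (param a)}.
  by apply: param_continuous; exists x.
by apply; rewrite coordK.
Qed.

Lemma coord_map_differentiable X Y (U : set X) (F : X -> Y) a b x :
  holomorphic_map_on U F -> atlas a -> atlas b -> U x -> dom a x -> dom b (F x) ->
  differentiable (coord b \o F \o param a) (coord a x).
Proof.
move=> [_ hF] aa ab Ux ax bFx; apply: holomorphic_differentiable (hF a b aa ab) _.
by exists x.
Qed.

Lemma jacobian_map_comp X Y Z (U : set X) (V : set Y) (F : X -> Y) (G : Y -> Z)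
    a b c x :
  holomorphic_map_on U F -> holomorphic_map_on V G ->
  atlas a -> atlas b -> atlas c ->
  U x -> V (F x) -> dom a x -> dom b (F x) -> dom c (G (F x)) ->
  'J (coord c \o (G \o F) \o param a) (coord a x) =
  'J (coord b \o F \o param a) (coord a x) *m
  'J (coord c \o G \o param b) (coord b (F x)).
Proof.
move=> hF hG aa ab ac Ux VFx ax bFx cGFx.
have dF := coord_map_differentiable hF aa ab Ux ax bFx.
have dG := coord_map_differentiable hG ab ac VFx bFx cGFx.
set f := coord b \o F \o param a in dF *; set g := coord c \o G \o param b in dG *.
have E : f (coord a x) = coord b (F x) by rewrite /f /= coordK.
apply: etrans _ (congr1 (fun z => 'J f (coord a x) *m 'J g z) E).
apply: etrans _ (jacobian_comp dF (eq_ind_r (fun z => differentiable g z) dG E)).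
apply/esym/near_eq_jacobian.
  have : \forall x' \near x, dom b (F x').
    by apply: (hF.1 x Ux); apply: open_nbhs_nbhs; split; [exact: open_dom|].
  move=> /(near_param ax); apply: filterS => z bz.
  by rewrite /f /g /= coordK.
apply: (differentiable_comp dF).
exact: (eq_ind_r (fun z => differentiable g z) dG E).
Qed.

Lemma holomorphic_map_id X : holomorphic_map (@id X).
Proof.
split=> [x _|a b aa ab]; first exact: cvg_id.
by rewrite setTI; exact: atlas_compat.
Qed.

End ChainRule.

Section PullbackStable.
Variables (R : realType) (n : nat) (X : cmanifold R n) (m : nat).
Local Notation C := R[i].

Lemma pullbackE (F : X -> X) (w : preform X) a b x :
  holomorphic_map F -> is_pluriform m setT w -> atlas a -> atlas b ->
  dom a x -> dom b (F x) ->
  pullback m F w x a =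
  w (F x) b * \det ('J (coord b \o F \o param a) (coord a x)) ^+ m.
Proof.
move=> hF wP aa ab ax bFx; set c := chart_at (F x).
have ac : atlas c := chart_at_atlas _; have cFx : dom c (F x) := dom_chart_at _.
have J := jacobian_map_comp hF (holomorphic_map_id X) aa ac ab I I ax cFx bFx.
transitivity (pullback_coef m w (F \o param a) (coord a x)).
  by rewrite /pullback asboolT.
have E : (F \o param a) (coord a x) = F x by rewrite /= coordK.
rewrite /pullback_coef E -/c.
apply: etrans (congr1 (fun t => t * _) (pluriform_cocycle wP I ac ab cFx bFx)) _.
apply: etrans (esym (mulrA _ _ _)) _; apply: congr1.
apply: etrans (esym (exprMn _ _ _)) _; apply: (congr1 (fun t => t ^+ m)).
apply: etrans (mulrC _ _) _; apply: etrans (esym (det_mulmx _ _)) _.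
exact: (congr1 determinant (esym J)).
Qed.

(* The chart a \o F', with domain F @` dom a. *)
Definition move_chart (F F' : X -> X) (hF : holomorphic_map F)
  (hF' : holomorphic_map F') (FK : cancel F F') (F'K : cancel F' F)
  (a : chart R n X) : chart R n X.
Proof.
refine (@Chart R n X (F' @^-1` dom a) (coord a \o F') (F \o param a) _ _ _ _ _).
- apply: open_comp; last exact: open_dom.
  by move=> x _; exact: (hF'.1 x I).
- rewrite (_ : _ @` _ = coord a @` dom a); first exact: open_img.
  apply/seteqP; split=> [_ [x ax <-]|_ [x ax <-]]; first by exists (F' x).
  by exists (F x); rewrite /= FK.
- by move=> x ax; rewrite /= coordK.
- move=> x ax; apply: (continuous_comp (hF'.1 x I)).
  exact: coord_continuous.
- move=> _ [x ax <-]; apply: continuous_comp; last exact: (hF.1 _ I).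
  by apply: param_continuous; exists (F' x).
Defined.

Lemma atlas_move_chart F F' hF hF' FK F'K a :
  atlas a -> atlas (@move_chart F F' hF hF' FK F'K a).
Proof.
move=> aa; apply: atlas_max => b ab; split.
- have := hF'.2 b a ab aa; rewrite setTI.
  exact.
- have := hF.2 a b aa ab; rewrite setTI; congr holomorphic.
  apply/seteqP; split=> _ [x [/= ax bx] <-].
    by exists (F x); rewrite /= ?FK.
  by exists (F' x); rewrite /= ?F'K.
Qed.

Lemma pullback_is_pluriform (F F' : X -> X) (w : preform X) :
  holomorphic_map F -> holomorphic_map F' -> cancel F F' -> cancel F' F ->
  is_pluriform m setT w -> is_pluriform m setT (pullback m F w).
Proof.
move=> hF hF' FK F'K wP; split.
- move=> x a nxa; rewrite /pullback asboolF // => -[aa ax].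
  exact: nxa.
- move=> x a b _ aa ab ax bx.
  have ac := chart_at_atlas (F x); have cFx := dom_chart_at (F x).
  have J := jacobian_map_comp (holomorphic_map_id X) hF aa ab ac I I ax bx cFx.
  apply: etrans (pullbackE hF wP aa ac ax cFx) _.
  apply: etrans _ (congr1 (fun t => t * _) (esym (pullbackE hF wP ab ac bx cFx))).
  apply: etrans _ (mulrA _ _ _); apply: congr1.
  apply: etrans _ (exprMn _ _ _); apply: (congr1 (fun t => t ^+ m)).
  apply: etrans (congr1 determinant J) _.
  by apply: etrans (det_mulmx _ _) _; exact: mulrC.
- move=> a aa; pose b := move_chart hF hF' FK F'K a.
  have ab : atlas b by exact: atlas_move_chart.
  have imgE : coord a @` (setT `&` dom a) = coord b @` (setT `&` dom b).
    rewrite !setTI; apply/seteqP; split=> [_ [x ax <-]|_ [x bx <-]].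
      by exists (F x); rewrite /= FK.
    by exists (F' x).
  have hw := pluriform_holomorphic wP ab; rewrite -imgE in hw.
  apply: eq_holomorphic hw; first exact/open_chart_img/openT.
  move=> _ [x [_ ax] <-].
  have bFx : dom b (F x) by rewrite /= FK.
  rewrite /= coordK //; apply/esym; apply: etrans (pullbackE hF wP aa ab ax bFx) _.
  have J : 'J (coord b \o F \o param a) (coord a x) = 1%:M.
    apply: etrans _ (jacobian_id (coord a x)); apply/esym/near_eq_jacobian.
      have : \forall z \near coord a x, (coord a @` dom a) z.
        by apply: open_nbhs_nbhs; split; [exact: open_img | exists x].
      by apply: filterS => _ [x' ax' <-]; rewrite /= FK coordK.
    exact: (@ex_diff _ _ _ _ _ _ _ (is_diff_id _)).
  apply: etrans (congr1 (fun A : 'M[C]_n => w (F x) b * \det A ^+ m) J) _.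
  by rewrite det1 expr1n mulr1.
Qed.

End PullbackStable.

Section Representation.
Variables (R : realType) (n : nat) (X : cmanifold R n) (m : nat).
Variables (gT : finGroupType) (act : gT -> X -> X) (hact : holomorphic_action act).
Local Notation C := R[i].

Lemma action_stable (g : gT) (w : pluriform X m) :
  pullback m (act g) w \in pluriform_pred m setT.
Proof.
have actVK h : cancel (act h) (act h^-1)%g.
  by move=> x; rewrite -(actM hact) mulVg (act1 hact).
have actKV : cancel (act g^-1)%g (act g) by move: (actVK g^-1)%g; rewrite invgK.
apply/asboolP; apply: pullback_is_pluriform (actVK g) actKV _.
- exact: act_holomorphic.
- exact: act_holomorphic.
- by have /asboolP := valP w.
Qed.

(* rho_m *)
Definition canonical_rep (g : gT) (w : pluriform X m) : pluriform X m :=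
  Pluriform (action_stable g w).

End Representation.

Section Constituents.
Variables (K : fieldType) (gT : finGroupType) (V : lmodType K).

(* chi is the character of an irreducible subrepresentation of V.  Here rho is
   a right action, rho (g * h) = rho h \o rho g, as is the pullback of forms and
   as are MathComp's matrix representations acting on row vectors.  V need not
   be known to have finite dimension: by Maschke's theorem these chi are
   the irreducible characters occurring in the decomposition of rho. *)
Definition irr_constituent (rho : gT -> V -> V) (chi : gT -> K) : Prop :=
  exists (d : nat) (rG : mx_representation K [set: gT]%G d)
         (iota : {linear 'rV[K]_d -> V}),
    [/\ mx_irreducible rG, injective iota,
        forall g v, iota (v *m rG g) = rho g (iota v) &
        forall g, chi g = \tr (rG g)].

End Constituents.

Section Projective.
Variable K : fieldType.

Definition linear_form_pred (V : lmodType K) : {pred V -> K^o} :=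
  fun f => `[< linear f >].

Lemma linear_form_submod_closed (V : lmodType K) :
  submod_closed (@linear_form_pred V).
Proof.
split=> [|c f g /asboolP lf /asboolP lg]; apply/asboolP => b u v.
  by rewrite -[RHS]/(b *: (0 : K^o) + 0) scaler0 addr0.
rewrite -[LHS]/(c *: f (b *: u + v) + g (b *: u + v)).
rewrite -[RHS]/(b *: (c *: f u + g u) + (c *: f v + g v)).
by rewrite lf lg !scalerDr !scalerA (mulrC b) addrACA.
Qed.

HB.instance Definition _ (V : lmodType K) :=
  GRing.isSubmodClosed.Build K (V -> K^o) (@linear_form_pred V)
    (@linear_form_submod_closed V).

Record dual (V : lmodType K) : Type :=
  Dual { dual_val :> V -> K^o; _ : dual_val \in @linear_form_pred V }.

HB.instance Definition _ (V : lmodType K) := [isSub for @dual_val V].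
HB.instance Definition _ (V : lmodType K) := [Choice of dual V by <:].
HB.instance Definition _ (V : lmodType K) := [SubChoice_isSubLmodule of dual V by <:].

(* The points of P(E) are the lines of E. *)
Definition line (E : lmodType K) (v : E) : set E := range (fun c : K => c *: v).

Record proj_space (E : lmodType K) := ProjSpace {
  proj_line : set E;
  proj_lineP : exists2 v, v != 0 & proj_line = line v }.

Definition proj_point (E : lmodType K) (v : E) (v_neq0 : v != 0) : proj_space E :=
  ProjSpace (ex_intro2 _ (fun u => line v = line u) v v_neq0 erefl).

End Projective.

Section Cover.
Variables (R : realType) (n : nat) (X Y : cmanifold R n).
Variables (gT : finGroupType) (act : gT -> X -> X) (pi : X -> Y) (m : nat).
Local Notation C := R[i].

(* Sections over W of the line bundle (pi_* K_X^m)^chi. *)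
Definition eigen_section (chi : gT -> C) (W : set Y) (s : preform X) : Prop :=
  is_pluriform m (pi @^-1` W) s /\
  forall g, pullback m (act g) s = chi g *: s.

(* s vanishes at y as a section of the line bundle L = (pi_* K_X^m)^chi, that is,
   the germ of s lies in m_y L_y; O_Y acts on L through pi. *)
Definition eigen_section_vanishes (chi : gT -> C) (s : preform X) (y : Y) : Prop :=
  exists (W : set Y) (f : Y -> C) (t : preform X),
    [/\ open W /\ W y, holomorphic_fun_on W f, f y = 0, eigen_section chi W t &
        forall x a, W (pi x) -> s x a = f (pi x) * t x a].

Definition eigen_base_locus (chi : gT -> C) : set Y :=
  [set y | forall s, eigen_section chi setT s -> eigen_section_vanishes chi s y].

Definition general_point (hact : holomorphic_action act) (y : Y) : Prop :=
  ~ branch_locus pi y /\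
  forall chi, irr_constituent (canonical_rep (m := m) hact) chi ->
    ~ eigen_base_locus chi y.

Record evaluation_data (y : Y) (x0 : X) (U : set X) (W : set Y) (sigma : R)
    (phi : chart R n X) : Prop := {
  eval_fibre : pi x0 = y;
  eval_nbhs : U x0;
  eval_biholomorphic : biholomorphic_onto U W pi;
  eval_preimage : pi @^-1` W = \bigcup_g act g @` U;
  eval_disjoint : forall g h, g <> h -> act g @` U `&` act h @` U = set0;
  eval_chart : atlas phi;
  eval_dom : dom phi = U;
  eval_radius : 0 < sigma;
  eval_ball : coord phi @` U =
    [set z | \sum_i `|z 0 i| ^+ 2 < (sigma ^+ 2)%:C%C];
  eval_center : coord phi x0 = 0 }.

(* ev_{g(x0)} = f_{g,w}(0), where (g \o phi^-1)^* w = f_{g,w} (dz_1 /\ ... /\ dz_n)^m *)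
Definition ev_fun (phi : chart R n X) (g : gT) (w : pluriform X m) : C^o :=
  pullback_coef m w (act g \o param phi) 0.

Lemma ev_linear phi g : ev_fun phi g \in @linear_form_pred C (pluriform X m).
Proof.
apply/asboolP => c v w; rewrite /ev_fun /pullback_coef.
set x := (_ \o _) 0; set d := _ ^+ m.
transitivity ((c * form_val v x (chart_at x) + form_val w x (chart_at x)) * d) => //.
by rewrite mulrDl -mulrA.
Qed.

Definition ev (phi : chart R n X) (g : gT) : dual (pluriform X m) :=
  Dual (ev_linear phi g).

End Cover.

(* Main.v *)
(** Each eigenform s of character chi satisfies ev_{g(x0)}(s) = chi(g) ev_{x0}(s).
    For every constituent chi of chi_m some eigenform does not vanish at x0: over
    W the eigensheaf is free, generated by the chi-equivariant extension of
    (dz_1 /\ ... /\ dz_n)^m, so an eigenform vanishing at x0 vanishes at y as a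
    section of it, while y is not in the base locus.  Hence
    ev_{g'(x0)} = c ev_{g(x0)} forces chi(g^-1 g') = c for all constituents chi.
    Conversely, if all constituents agree at h, then h acts on H^0 by a scalar,
    and ev_{h(x0)} is proportional to ev_{x0}. *)
Require Import Defs.
From HB Require Import structures.
From mathcomp Require Import all_boot all_order all_algebra all_fingroup.
From mathcomp Require Import all_character.
From mathcomp Require Import complex.
From mathcomp Require Import all_classical all_reals all_analysis.
(* Restores Defs.dom, which fingroup shadows. *)
Import Defs.

Set Implicit Arguments.
Unset Strict Implicit.
Unset Printing Implicit Defensive.

Import Order.TTheory GRing.Theory Num.Theory.
Import numFieldNormedType.Exports.

Local Open Scope classical_set_scope.
Local Open Scope ring_scope.

(** * Common eigenvectors of a finite abelian group *)

Lemma eq_proj_point (K : fieldType) (V : lmodType K) (v w : V)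
    (v0 : v != 0) (w0 : w != 0) :
  proj_point v0 = proj_point w0 <-> exists2 c, c != 0 & w = c *: v.
Proof.
have lineP (u t : V) (u0 : u != 0) : proj_line (proj_point u0) t <-> exists c, c *: u = t.
  by split=> [[c _ <-]|[c <-]]; exists c.
split=> [E|[c c0 wE]].
  have [c wE] : exists c, c *: v = w
    by apply/(lineP v w v0); rewrite E; apply/lineP; exists 1; rewrite scale1r.
  by exists c => //; move: (w0); rewrite -wE scaler_eq0 negb_or => /andP[].
have L : line v = line w.
  apply/seteqP; split=> _ [b _ <-].
    by exists (b / c) => //; rewrite wE scalerA divfK.
  by exists (b * c) => //; rewrite wE scalerA.
(* A point carries a proof about its line, so both proofs are generalized before the lines are
   identified and are then equal by proof irrelevance. *)
rewrite /proj_point; move: (ex_intro2 _ _ v _ _) (ex_intro2 _ _ w _ _).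
by rewrite L => p q; congr ProjSpace; exact: Prop_irrelevance.
Qed.

Definition pack_linear (K : fieldType) (V W : lmodType K) (f : V -> W)
    (f_lin : linear f) : {linear V -> W} :=
  HB.pack f (GRing.isLinear.Build K V W _ f f_lin).

Section Eigen.
Variables (K : numClosedFieldType) (V : lmodType K).

(** No dimension is available, so an annihilating polynomial takes the place of the characteristic
    one. Write p = q(X - z): either q(T)u is nonzero and killed by T - z, or q annihilates u and has
    smaller degree. *)
Lemma eigenvector_in_submodule (P : V -> Prop) (T : {linear V -> V}) (p : {poly K})
    (u : V) :
  (forall a v w, P v -> P w -> P (a *: v + w)) -> (forall v, P v -> P (T v)) ->
  P u -> u != 0 -> p != 0 -> \sum_(i < size p) p`_i *: iter i T u = 0 ->
  exists v z, [/\ v != 0, P v & T v = z *: v].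
Proof.
move=> Plin PT Pu u0.
have P0 : P 0 by have := Plin (-1) _ _ Pu Pu; rewrite scaleN1r addNr.
have Piter i : P (iter i T u) by elim: i => //= i; exact: PT.
have [n] := ubnP (size p); elim: n p => // n IHn p; rewrite ltnS => sp p0 pu0.
have [/size_poly1P [c c0 pE]|sp1] := boolP (size p == 1).
  move: pu0; rewrite pE size_polyC c0 big_ord1 coefC /= => /eqP.
  by rewrite scaler_eq0 (negbTE c0) (negbTE u0).
have [z /factor_theorem [q pE]] := closed_rootP p sp1.
have q0 : q != 0 by apply: contraNneq p0 => q0; rewrite pE q0 mul0r.
have spq : size p = (size q).+1 by rewrite pE size_Mmonic ?monicXsubC // size_XsubC addn2.
pose v := \sum_(i < size q) q`_i *: iter i T u.
have Pv : P v.
  by rewrite /v; elim/big_rec: _ => // i x _ Px; exact: Plin.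
have [v0|v0] := eqVneq v 0; first by apply: (IHn q); rewrite // -spq.
exists v, z; split=> //; apply/eqP; rewrite -subr_eq0; apply/eqP.
rewrite -[RHS]pu0 spq /v linear_sum scaler_sumr.
(* Coefficients of q(X - z). The case i = 0 is set apart because [0.-1] is 0, which would wrongly
   contribute the constant term of q. *)
have coefE i : p`_i *: iter i T u =
    (if i == 0%N then 0 else q`_i.-1) *: iter i T u - (q`_i * z) *: iter i T u.
  by rewrite pE mulrBr coefB coefMX coefMC scalerBl.
under [RHS]eq_bigr do rewrite coefE.
rewrite sumrB big_ord_recl /= scale0r add0r; congr (_ - _).
  by apply: eq_bigr => i _; rewrite linearZ.
rewrite big_ord_recr /= nth_default // mul0r scale0r addr0.
by apply: eq_bigr => i _; rewrite scalerA mulrC.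
Qed.

Section Rep.
Variables (gT : finGroupType) (rho : gT -> V -> V).
Hypotheses (abG : abelian [set: gT]%SET) (rho_lin : forall g, linear (rho g)).
Hypotheses (rho1 : forall u, rho 1%g u = u)
  (rhoM : forall g h u, rho (g * h)%g u = rho h (rho g u)).

Lemma rhoZ g a u : rho g (a *: u) = a *: rho g u.
Proof. exact: (linearZ_LR (pack_linear (rho_lin g))). Qed.

Lemma rhoC g h u : rho g (rho h u) = rho h (rho g u).
Proof. by rewrite -!rhoM; congr rho; apply: (centsP abG); rewrite inE. Qed.

Lemma rhoX g i u : iter i (rho g) u = rho (g ^+ i)%g u.
Proof. by elim: i => [|i IHi]; rewrite ?rho1 // expgSr rhoM -IHi. Qed.

(** Elements of the group are treated one at a time. Commutativity makes the joint eigenspace of the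
    earlier ones invariant, and X^#[g] - 1 annihilates the action of g on it. *)
Lemma common_eigenvector_in_submodule (P : V -> Prop) (u : V) :
  (forall a v w, P v -> P w -> P (a *: v + w)) -> (forall g v, P v -> P (rho g v)) ->
  P u -> u != 0 ->
  exists chi v, [/\ v != 0, P v & forall g, rho g v = chi g *: v].
Proof.
move=> Plin Prho Pu u0.
suff [chi [v [v0 Pv chiv]]] : exists chi v, [/\ v != 0, P v &
    forall g, g \in enum gT -> rho g v = chi g *: v].
  by exists chi, v; split=> // g; apply: chiv; rewrite mem_enum.
elim: (enum gT) => [|g s [chi [v [v0 Pv chiv]]]].
  by exists (fun=> 0), u.
pose T := pack_linear (rho_lin g).
pose Q w := P w /\ forall h, h \in s -> rho h w = chi h *: w.
pose p : {poly K} := 'X^#[g]%g - 1.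
have p0 : p != 0 by rewrite -size_poly_eq0 size_XnsubC.
have hp : size p = #[g]%g.+1 by rewrite size_XnsubC.
have [] := @eigenvector_in_submodule Q T p v => //.
- move=> a w w' [Pw chiw] [Pw' chiw']; split; first exact: Plin.
  by move=> h hs; rewrite rho_lin chiw // chiw' // scalerDr !scalerA mulrC.
- move=> w [Pw chiw]; split; first exact: Prho.
  by move=> h hs; rewrite [LHS]rhoC chiw // rhoZ.
- have [k gE] : exists k, #[g]%g = k.+1 by exists #[g]%g.-1; rewrite prednK.
  have pE i : p`_i = (i == k.+1)%:R - (i == 0)%:R by rewrite coefB coefXn coef1 gE.
  rewrite hp gE big_ord_recr big_ord_recl /= !pE eqxx /= sub0r subr0.
  rewrite scaleN1r scale1r big1 => [|i _]; last first.
    by rewrite pE /= /bump /= eqSS ltn_eqF ?subrr ?scale0r.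
  by rewrite addr0 -/(iter k.+1 (rho g) v) rhoX -gE expg_order rho1 addNr.
move=> w [z [w0 [Pw chiw] zw]].
(* Overwriting the value at g is harmless even if g recurs in [s]: w has eigenvalue z there. *)
exists (fun h => if h == g then z else chi h), w; split=> // h.
by rewrite inE; case: eqVneq => [->|_] //= hs; exact: chiw.
Qed.

Lemma eigenvalueM chi v : v != 0 -> (forall g, rho g v = chi g *: v) ->
  forall g h, chi (g * h)%g = chi g * chi h.
Proof.
move=> v0 chiv g h; apply/eqP; rewrite -subr_eq0.
have /eqP : (chi (g * h)%g - chi g * chi h) *: v = 0.
  rewrite scalerBl -chiv rhoM chiv rhoZ chiv.
  by rewrite scalerA subrr.
by rewrite scaler_eq0 (negbTE v0) orbF.
Qed.

Lemma eigenvalue1 chi v : v != 0 -> (forall g, rho g v = chi g *: v) ->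
  chi 1%g = 1.
Proof.
move=> v0 chiv; apply/eqP; rewrite -subr_eq0.
have /eqP : (chi 1%g - 1) *: v = 0 by rewrite scalerBl -chiv rho1 scale1r subrr.
by rewrite scaler_eq0 (negbTE v0) orbF.
Qed.

Lemma eigenvalue_neq0 chi v : v != 0 -> (forall g, rho g v = chi g *: v) ->
  forall g, chi g != 0.
Proof.
move=> v0 chiv g; apply: contra_neq (oner_neq0 K) => chig0.
by rewrite -(eigenvalue1 v0 chiv) -(mulgV g) (eigenvalueM v0 chiv) chig0 mul0r.
Qed.

(** The line spanned by v is a subrepresentation of dimension one, hence irreducible, and its trace
    is chi. *)
Lemma eigenvalue_irr_constituent chi v :
  v != 0 -> (forall g, rho g v = chi g *: v) -> irr_constituent rho chi.
Proof.
move=> v0 chiv.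
have rP : mx_repr [set: gT]%SET (fun g => (chi g)%:M : 'M[K]_1).
  split=> [|g h _ _]; first by rewrite (eigenvalue1 v0 chiv).
  by rewrite (eigenvalueM v0 chiv) scalar_mxM.
pose f (u : 'rV[K]_1) : V := u 0 0 *: v.
have flin : linear f by move=> a u w; rewrite /f !mxE scalerDl scalerA.
exists 1%N, (MxRepresentation rP), (pack_linear flin); split.
- exact/mx_abs_irrW/linear_mx_abs_irr.
- move=> u w /eqP; rewrite -subr_eq0 -scalerBl scaler_eq0 (negbTE v0) orbF subr_eq0.
  by move=> /eqP uw; apply/rowP => i; rewrite ord1.
- move=> g u /=; rewrite /f rhoZ chiv.
  by rewrite mul_mx_scalar mxE scalerA mulrC.
- by move=> g /=; rewrite mxtrace_scalar.
Qed.

(* A vector that h does not scale by c leaves a nonzero invariant subspace on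
   which the averaging operator sum_i c^-i h^i vanishes; common eigenvectors
   taken there have a different eigenvalue. *)
Lemma irr_constituent_neq (h : gT) (c : K) (w : V) :
  c ^+ #[h]%g = 1 -> rho h w != c *: w ->
  exists2 chi, irr_constituent rho chi & chi h != c.
Proof.
move=> cX hw.
have c0 : c != 0.
  apply: contra_eq_neq cX => ->; rewrite expr0n gtn_eqF ?order_gt0 //.
  by rewrite eq_sym oner_neq0.
pose P v := \sum_(0 <= i < #[h]%g) c ^- i *: rho (h ^+ i)%g v = 0.
have [||||chi [v [v0 Pv chiv]]] :=
    @common_eigenvector_in_submodule P (rho h w - c *: w).
- move=> a v v' Pv Pv'; rewrite /P.
  under eq_bigr do rewrite rho_lin scalerDr scalerA mulrC -scalerA.
  by rewrite big_split /= -scaler_sumr Pv Pv' scaler0 addr0.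
- move=> g v Pv; rewrite /P.
  under eq_bigr do rewrite rhoC -rhoZ.
  rewrite -[LHS](linear_sum (pack_linear (rho_lin g))) Pv.
  exact: (linear0 (pack_linear (rho_lin g))).
(* Applied to h w - c w the averaging sum telescopes, and its end terms agree because both h and c
   have #[h]-th power 1. *)
- pose F i := c *: (c ^- i *: rho (h ^+ i)%g w).
  rewrite /P (eq_bigr (fun i => F i.+1 - F i)) => [|i _].
    rewrite telescope_sumr // /F expg_order expg0 expr0 invr1 cX invr1.
    by rewrite !scale1r subrr.
  have -> : rho h w - c *: w = (- c) *: w + rho h w by rewrite scaleNr addrC.
  rewrite rho_lin -rhoM -expgS scalerDr addrC /F !scalerA -scaleNr.
  congr (_ *: _ + _ *: _); first by rewrite exprS invfM mulVKf.
  by rewrite mulrN mulrC.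
- by rewrite subr_eq0.
exists chi; first exact: eigenvalue_irr_constituent v0 chiv.
(* If chi h were c, every term of the sum would be v, so #[h] v = 0 and v = 0 in characteristic
   zero. *)
apply: contra_neqN v0 => /eqP chih.
have chiX i : rho (h ^+ i)%g v = c ^+ i *: v.
  elim: i => [|i IHi]; first by rewrite rho1 scale1r.
  by rewrite expgSr rhoM IHi rhoZ chiv chih scalerA exprSr.
move: Pv; rewrite /P (eq_bigr (fun=> v)) => [|i _]; last first.
  by rewrite chiX scalerA mulVf ?scale1r // expf_neq0.
rewrite sumr_const_nat subn0 -scaler_nat => /eqP.
by rewrite scaler_eq0 pnatr_eq0 gtn_eqF ?order_gt0 //= => /eqP.
Qed.

End Rep.

(** * Linear forms along a group orbit and their projective classes *)

Lemma dual_linear (l : dual V) : linear l.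
Proof. by case: l => l /= /asboolP. Qed.

Lemma dual_eqP (l l' : dual V) : l = l' <-> l =1 l'.
Proof. by split=> [->//|E]; apply: val_inj; apply/funext. Qed.

(** This is the representation-theoretic half of the argument. Geometry enters only through the last
    hypothesis, which gives for each constituent an eigenvector not killed by [l 1%g]. *)
Lemma injective_orbit_projective (gT : finGroupType) (rho : gT -> V -> V)
    (l : gT -> dual V) :
  abelian [set: gT]%SET -> (forall g, linear (rho g)) -> (forall u, rho 1%g u = u) ->
  (forall g h u, rho (g * h)%g u = rho h (rho g u)) ->
  (exists w : V, w != 0) -> (forall g w, l g w = l 1%g (rho g w)) ->
  (forall chi, irr_constituent rho chi ->
     exists2 s, forall g, rho g s = chi g *: s & l 1%g s != 0) ->
  exists l_neq0 : forall g, l g != 0,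
    injective (fun g => proj_point (l_neq0 g)) <->
    (forall h, h <> 1%g -> exists chi chi',
       [/\ irr_constituent rho chi, irr_constituent rho chi' & chi h <> chi' h]).
Proof.
move=> abG rho_lin rho1 rhoM [w0 w0n0] lrho gen.
have lZ g a v : l g (a *: v) = a * l g v.
  have l0 : l g 0 = 0.
    by have := dual_linear (l g) (-1) 0 0; rewrite scaler0 addr0 scaleN1r addNr.
  by have := dual_linear (l g) a v 0; rewrite addr0 l0 addr0.
have s_n0 s : l 1%g s != 0 -> s != 0.
  by apply: contra_neq => ->; rewrite -(scale0r 0) lZ mul0r.
(* A nonzero space has at least one constituent; chi0 serves both for the nonvanishing of the forms
   and as the reference value at h. *)
have [chi0 [v0 [v0n0 _ chi0v0]]] := common_eigenvector_in_submodule
  abG rho_lin rho1 rhoM (P := fun=> True) (fun _ _ _ _ _ => I) (fun _ _ _ => I) I w0n0.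
have chi0P := eigenvalue_irr_constituent rho_lin rho1 rhoM v0n0 chi0v0.
have l_n0 g : l g != 0.
  have [s sE ls] := gen _ chi0P; apply/negP => /eqP lg0.
  have := eigenvalue_neq0 rho_lin rho1 rhoM (s_n0 _ ls) sE g.
  have : l g s = 0 by rewrite lg0.
  by rewrite lrho sE lZ => /eqP; rewrite mulf_eq0 (negbTE ls) orbF => ->.
exists l_n0; split=> [inj h h1|sep g g' /eq_proj_point [c c0 lE]].
  apply: contrapT => nsep.
  have chih chi : irr_constituent rho chi -> chi h = chi0 h.
    by move=> chiP; apply: contrapT => neq; apply: nsep; exists chi, chi0.
  have cn0 := eigenvalue_neq0 rho_lin rho1 rhoM v0n0 chi0v0 h.
  (* Being a root of unity of this order is what [irr_constituent_neq] asks of a candidate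
     scalar. *)
  have cX : chi0 h ^+ #[h]%g = 1.
    have chiX i : chi0 (h ^+ i)%g = chi0 h ^+ i.
      elim: i => [|i IHi]; first exact: (eigenvalue1 rho1 v0n0 chi0v0).
      by rewrite expgSr (eigenvalueM rho_lin rhoM v0n0 chi0v0) IHi exprSr.
    by rewrite -chiX expg_order (eigenvalue1 rho1 v0n0 chi0v0).
  have scal w : rho h w = chi0 h *: w.
    apply: contrapT => /eqP /(irr_constituent_neq abG rho_lin rho1 rhoM cX).
    by case=> chi /chih ->; rewrite eqxx.
  apply/h1/esym/inj/eq_proj_point; exists (chi0 h) => //.
  by apply/dual_eqP => w; rewrite lrho scal lZ.
apply: contrapT => gg'.
have [|chi [chi' [chiP chi'P]]] := sep (g^-1 * g')%g.
  by move=> /(canRL (mulKVg g)); rewrite mulg1 => /esym.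
(* Evaluating [l g' = c *: l g] on an eigenvector of k gives k(g') = c k(g), with the same c for all
   k. *)
suff chic k : irr_constituent rho k -> k (g^-1 * g')%g = c by rewrite !chic.
move=> /gen [s sE ls].
have kM := eigenvalueM rho_lin rhoM (s_n0 _ ls) sE.
have kn0 := eigenvalue_neq0 rho_lin rho1 rhoM (s_n0 _ ls) sE.
have : l g' s = c * l g s by rewrite lE.
rewrite (lrho g') (lrho g) !sE !lZ mulrA => /(mulIf ls) kE.
by apply: (mulfI (kn0 g)); rewrite -kM mulKVg kE mulrC.
Qed.

End Eigen.

(** * Closure properties of holomorphic functions *)

Section HolomorphicClosure.
Context {K : numFieldType} {V W : normedModType K}.
Implicit Types (U : set V) (f g : V -> W).

Lemma Cdifferentiable_local k U f :
  (forall z, U z -> exists2 U', U' z & Cdifferentiable k U' f) ->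
  Cdifferentiable k U f.
Proof.
elim: k f => //= k IHk f loc; split=> [z /loc[U' U'z [df _]]|v]; first exact: df.
by apply: IHk => z /loc[U' U'z [_ dDf]]; exists U'.
Qed.

Lemma holomorphic_local U f :
  (forall z, U z -> exists2 U', U' z & holomorphic U' f) -> holomorphic U f.
Proof.
move=> loc k; apply: Cdifferentiable_local => z /loc[U' U'z hf].
by exists U'; [|exact: hf].
Qed.

Lemma CdifferentiableW k U f : Cdifferentiable k.+1 U f -> Cdifferentiable k U f.
Proof.
elim: k f => // k IHk f [df dDf]; split=> // v; exact: IHk.
Qed.

Lemma Cdifferentiable_cst k U (c : W) : Cdifferentiable k U (fun=> c).
Proof.
elim: k c => //= k IHk c; split=> [z _|v]; first exact: differentiable_cst.
have -> : (fun z => 'D_v (fun=> c) z) = (fun=> 0) :> (V -> W); last exact: IHk.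
by apply/funext => z; rewrite derive_cst.
Qed.

(** The product and chain rules below go by induction on the order, so closure is needed at each
    fixed k and not only for [holomorphic]. *)
Lemma Cdifferentiable_lin k U f g (c : K) : open U ->
  Cdifferentiable k U f -> Cdifferentiable k U g ->
  Cdifferentiable k U (fun z => c *: f z + g z).
Proof.
move=> oU; elim: k f g => //= k IHk f g.
move=> [df dDf] [dg dDg]; split=> [z Uz|v].
  change (differentiable (c *: f + g) z).
  by apply: differentiableD (dg z Uz); exact: differentiableZ (df z Uz).
apply: eq_Cdifferentiable (IHk _ _ (dDf v) (dDg v)) => // z Uz.
rewrite -[RHS]/('D_v (c *: f + g) z) deriveD ?deriveZ //.
- exact: diff_derivable (df z Uz).
- exact: derivableZ (diff_derivable (df z Uz)).
- exact: diff_derivable (dg z Uz).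
Qed.

Lemma Cdifferentiable_sum k U I (r : seq I) (F : I -> V -> W) : open U ->
  (forall i, Cdifferentiable k U (F i)) ->
  Cdifferentiable k U (fun z => \sum_(i <- r) F i z).
Proof.
move=> oU hF; elim: r => [|i r IHr].
  rewrite (_ : (fun z => _) = (fun=> 0)); first exact: Cdifferentiable_cst.
  by apply/funext => z; rewrite big_nil.
rewrite (_ : (fun z => _) = (fun z => 1 *: F i z + \sum_(i <- r) F i z)).
  exact: Cdifferentiable_lin.
by apply/funext => z; rewrite big_cons scale1r.
Qed.

End HolomorphicClosure.

Section HolomorphicProduct.
Context {K : numFieldType} {V : normedModType K}.
Implicit Types (U : set V) (f g : V -> K^o).

Lemma Cdifferentiable_mul k U f g : open U ->
  Cdifferentiable k U f -> Cdifferentiable k U g ->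
  Cdifferentiable k U (fun z => f z * g z : K^o).
Proof.
move=> oU; elim: k f g => // k IHk f g df dg.
have [wf wg] := (CdifferentiableW df, CdifferentiableW dg).
case: df dg => df dDf [dg dDg]; split=> [z Uz|v].
  exact: differentiableM (df z Uz) (dg z Uz).
have h := Cdifferentiable_lin 1 oU (IHk _ _ wf (dDg v)) (IHk _ _ wg (dDf v)).
apply: eq_Cdifferentiable h => // z Uz.
rewrite scale1r -[RHS]/('D_v (f * g) z) deriveM //.
- exact: diff_derivable (df z Uz).
- exact: diff_derivable (dg z Uz).
Qed.

Lemma Cdifferentiable_prod k U I (r : seq I) (F : I -> V -> K^o) : open U ->
  (forall i, Cdifferentiable k U (F i)) ->
  Cdifferentiable k U (fun z => \prod_(i <- r) F i z : K^o).
Proof.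
move=> oU hF; elim: r => [|i r IHr].
  rewrite (_ : (fun z => _) = (fun=> 1)); first exact: Cdifferentiable_cst.
  by apply/funext => z; rewrite big_nil.
rewrite (_ : (fun z => _) = (fun z => F i z * \prod_(i <- r) F i z)).
  exact: Cdifferentiable_mul.
by apply/funext => z; rewrite big_cons.
Qed.

End HolomorphicProduct.

Section HolomorphicComposition.
Context {K : numFieldType} {V : normedModType K} {n : nat}.
Implicit Types (U : set V) (f : V -> 'rV[K]_n).

Lemma coord_linear (j : 'I_n) : linear (fun v : 'rV[K]_n => v 0 j : K^o).
Proof. by move=> a u v; rewrite !mxE. Qed.

Lemma Cdifferentiable_coord k U f (j : 'I_n) : open U ->
  Cdifferentiable k U f -> Cdifferentiable k U (fun z => f z 0 j : K^o).
Proof.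
move=> oU; elim: k f => //= k IHk f [df dDf].
have dc w := @differentiable_coord K 1 n w 0 j.
split=> [z Uz|v]; first exact: (differentiable_comp (df z Uz) (dc _)).
apply: eq_Cdifferentiable (IHk _ (dDf v)) => // z Uz.
pose c : {linear 'rV[K]_n -> K^o} := pack_linear (coord_linear j).
have dcf : differentiable (c \o f) z := differentiable_comp (df z Uz) (dc _).
rewrite (deriveE _ (df z Uz)) -[RHS]/('D_v (c \o f) z) (deriveE _ dcf).
have E := congr1 (fun h : V -> K^o => h v) (diff_comp (df z Uz) (dc (f z))).
apply: etrans _ (esym E) => /=.
have cc : continuous c by move=> w; exact: differentiable_continuous (dc w).
by have /= -> := congr1 (fun h : 'rV[K]_n -> K^o => h ('d f z v)) (diff_lin (f z) cc).
Qed.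

(** The derivative of g along the varying vector D_v f(z) is expanded in the basis, since the
    induction hypothesis covers only derivatives of g in fixed directions. *)
Lemma Cdifferentiable_comp k U (U' : set 'rV[K]_n) f (g : 'rV[K]_n -> K^o) :
  open U -> (forall z, U z -> U' (f z)) ->
  Cdifferentiable k U f -> Cdifferentiable k U' g -> Cdifferentiable k U (g \o f).
Proof.
move=> oU fU; elim: k g => // k IHk g df dg; have wf := CdifferentiableW df.
case: df dg => df dDf [dg dDg]; split=> [z Uz|v].
  exact: differentiable_comp (df z Uz) (dg _ (fU z Uz)).
have h : Cdifferentiable k U
    (fun z => \sum_j ('D_v f z 0 j * ('D_('e_j) g \o f) z) : K^o).
  apply: Cdifferentiable_sum => // j; apply: Cdifferentiable_mul => //.
    exact: Cdifferentiable_coord (dDf v).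
  exact: (IHk _ wf (dDg 'e_j)).
apply: eq_Cdifferentiable h => // z Uz; have dgz := dg _ (fU z Uz).
rewrite (deriveE _ (differentiable_comp (df z Uz) dgz)).
have E := congr1 (fun h : V -> K^o => h v) (diff_comp (df z Uz) dgz).
apply: etrans _ (esym E) => /=.
rewrite (deriveE _ (df z Uz)) [in RHS](row_sum_delta ('d f z v)) linear_sum.
by apply: eq_bigr => j _; rewrite linearZ (deriveE _ dgz).
Qed.

End HolomorphicComposition.

Section HolomorphicJacobian.
Context {K : numFieldType} {n : nat}.
Implicit Types (U : set 'rV[K]_n) (f : 'rV[K]_n -> 'rV[K]_n).

Lemma jacobianE f z i j : differentiable f z -> 'J f z i j = 'D_('e_i) f z 0 j.
Proof.
move=> df; rewrite (deriveE _ df); have /rowP/(_ j) := mul_jacobian 'e_i f z.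
by rewrite -rowE mxE.
Qed.

(** The Leibniz formula makes the determinant a polynomial in first partial derivatives; order k for
    it uses order k+1 for f. *)
Lemma holomorphic_det_jacobian U f m : open U -> holomorphic U f ->
  holomorphic U (fun z => \det ('J f z) ^+ m : K^o).
Proof.
move=> oU hf k; have [df dDf] := hf k.+1.
have hdet : Cdifferentiable k U (fun z => \det ('J f z) : K^o).
  have h : Cdifferentiable k U (fun z => \sum_(s : 'S_n)
      (-1) ^+ s * \prod_i ('D_('e_i) f z 0 (s i) : K^o) : K^o).
    apply: Cdifferentiable_sum => // s.
    apply: Cdifferentiable_mul => //; first exact: Cdifferentiable_cst.
    apply: Cdifferentiable_prod => // i.
    exact: (Cdifferentiable_coord (s i) oU (dDf 'e_i)).
  apply: eq_Cdifferentiable h => // z Uz; apply: eq_bigr => s _.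
  by congr (_ * _); apply: eq_bigr => i _; rewrite jacobianE //; exact: df.
rewrite (_ : (fun z => _) = fun z => \prod_(i < m) \det ('J f z)).
  exact: Cdifferentiable_prod.
by apply/funext => z; rewrite prodr_const card_ord.
Qed.

End HolomorphicJacobian.

(** * Pullback of pluricanonical forms *)

Section PluriformPullback.
Variables (R : realType) (n : nat) (X : cmanifold R n) (m : nat).
Local Notation C := R[i].

(** F reads as the identity in these two charts, so the Jacobian factor is 1. *)
Lemma pullback_transport (F : X -> X) (w : preform X) a b x :
  holomorphic_map F -> is_pluriform m setT w -> atlas a -> atlas b ->
  dom a x -> dom b (F x) -> (forall x', dom a x' -> coord b (F x') = coord a x') ->
  pullback m F w x a = w (F x) b.
Proof.
move=> hF wP aa ab ax bFx ba; apply: etrans (pullbackE hF wP aa ab ax bFx) _.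
have J : 'J (coord b \o F \o param a) (coord a x) = 1%:M.
  apply: etrans _ (jacobian_id (coord a x)); apply/esym/near_eq_jacobian.
    have : \forall z \near coord a x, (coord a @` dom a) z.
      by apply: open_nbhs_nbhs; split; [exact: open_img | exists x].
    by apply: filterS => _ [x' ax' <-]; rewrite /= coordK // ba.
  exact: (@ex_diff _ _ _ _ _ _ _ (is_diff_id _)).
apply: etrans (congr1 (fun A : 'M[C]_n => w (F x) b * \det A ^+ m) J) _.
by rewrite det1 expr1n mulr1.
Qed.

Lemma pullback_linear (F : X -> X) : linear (pullback m F : preform X -> preform X).
Proof.
move=> c v w; apply/funext => x; apply/funext => a.
rewrite -[RHS]/(c * pullback m F v x a + pullback m F w x a) /pullback.
case: ifP => _; last by rewrite mulr0 addr0.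
rewrite /pullback_coef; set y := (_ \o _) _; set d := _ ^+ m.
transitivity ((c * v y (chart_at y) + w y (chart_at y)) * d) => //.
by rewrite mulrDl -mulrA.
Qed.

(** This is the coefficient in the chart a of the m-th power of dz_1 /\ ... /\ dz_n, for z the
    coordinates of b. *)
Definition trans_factor (a b : chart R n X) (x : X) : C :=
  \det ('J (coord b \o param a) (coord a x)) ^+ m.

Lemma trans_factor_comp a b c x : atlas a -> atlas b -> atlas c ->
  dom a x -> dom b x -> dom c x ->
  trans_factor a c x = trans_factor b c x * trans_factor a b x.
Proof.
move=> aa ab ac ax bx cx; rewrite /trans_factor.
have h := @holomorphic_map_id R n X.
have J := jacobian_map_comp h h aa ab ac I I ax bx cx.
apply: etrans (congr1 (fun A : 'M[C]_n => \det A ^+ m) J) _.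
apply: etrans _ (exprMn _ _ _); apply: (congr1 (fun t => t ^+ m)).
by apply: etrans (det_mulmx _ _) _; exact: mulrC.
Qed.

Lemma pluriform0 (U : set X) : is_pluriform m U (0 : preform X).
Proof.
split=> // [x a b *|a _]; last exact: holomorphic0.
by apply/esym; exact: mul0r.
Qed.

(** * Charts moved by the group and the canonical representation *)

Section Action.
Variables (gT : finGroupType) (act : gT -> X -> X) (hact : holomorphic_action act).

Lemma actVK g : cancel (act g) (act g^-1)%g.
Proof. by move=> x; rewrite -(actM hact) mulVg (act1 hact). Qed.

Lemma actKV g : cancel (act g^-1)%g (act g).
Proof. by move=> x; rewrite -(actM hact) mulgV (act1 hact). Qed.

(** Its coordinates are those of a after g^-1, so g is the identity from a to this chart and pulling
    back by g involves no Jacobian. *)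
Definition translate_chart g (a : chart R n X) : chart R n X :=
  move_chart (act_holomorphic hact g) (act_holomorphic hact g^-1)
    (actVK g) (actKV g) a.

Lemma atlas_translate g a : atlas a -> atlas (translate_chart g a).
Proof. exact: atlas_move_chart. Qed.

Lemma dom_translate g a x : dom a x -> dom (translate_chart g a) (act g x).
Proof. by rewrite /= actVK. Qed.

Lemma pullback_translate g w a x : is_pluriform m setT w -> atlas a -> dom a x ->
  pullback m (act g) w x a = w (act g x) (translate_chart g a).
Proof.
move=> wP aa ax; apply: pullback_transport => //.
- exact: act_holomorphic.
- exact: atlas_translate.
- exact: dom_translate.
- by move=> x' _; rewrite /= actVK.
Qed.

Local Notation rho := (canonical_rep (m := m) hact).

Lemma pluriform_eq (v w : pluriform X m) :
  (forall x a, atlas a -> dom a x -> form_val v x a = form_val w x a) -> v = w.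
Proof.
move=> vw; apply: val_inj; apply/funext => x; apply/funext => a.
have [[aa ax]|nax] := pselect (atlas a /\ dom a x); first exact: vw.
have /asboolP vP := valP v; have /asboolP wP := valP w.
rewrite [LHS](pluriform_support vP) ?[RHS](pluriform_support wP) //.
- by case=> _ aa ax; apply: nax.
- by case=> _ aa ax; apply: nax.
Qed.

Lemma canonical_rep_linear g : linear (rho g).
Proof.
move=> c v w; apply: val_inj.
exact: (pullback_linear (act g) c (form_val v) (form_val w)).
Qed.

Lemma canonical_rep1 w : rho 1%g w = w.
Proof.
apply: pluriform_eq => x a aa ax; have /asboolP wP := valP w.
rewrite -[in RHS](act1 hact x); apply: pullback_transport => //.
- exact: act_holomorphic.
- by rewrite (act1 hact).
- by move=> x' _; rewrite (act1 hact).
Qed.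

Lemma canonical_repM g h w : rho (g * h)%g w = rho h (rho g w).
Proof.
apply: pluriform_eq => x a aa ax; have /asboolP wP := valP w.
have /asboolP gwP := valP (rho g w).
(* The chart is moved by h first and then by g, which matches the point: g * h acts as h followed by
   g. *)
have -> : form_val (rho h (rho g w)) x a =
    form_val w (act (g * h)%g x) (translate_chart g (translate_chart h a)).
  apply: etrans (pullback_translate h gwP aa ax) _.
  apply: etrans
    (pullback_translate g wP (atlas_translate h aa) (dom_translate h ax)) _.
  by rewrite (actM hact).
apply: pullback_transport => //.
- exact: act_holomorphic.
- exact/atlas_translate/atlas_translate.
- by rewrite (actM hact); exact/dom_translate/dom_translate.
- by move=> x' _; rewrite (actM hact) /= !actVK.
Qed.

End Action.
End PluriformPullback.

(** * Sections of the eigensheaves *)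

Section EigenGenerator.
Variables (R : realType) (n : nat) (X Y : cmanifold R n) (m : nat).
Variables (gT : finGroupType) (act : gT -> X -> X) (pi : X -> Y).
Hypothesis hact : holomorphic_action act.
Local Notation C := R[i].
Variables (U : set X) (W : set Y) (phi : chart R n X).
Hypotheses (atlas_phi : atlas phi) (dom_phi : dom phi = U).
Hypotheses (preW : pi @^-1` W = \bigcup_g act g @` U)
  (disjU : forall g h, g <> h -> act g @` U `&` act h @` U = set0).
Variable chi : gT -> C.
Hypothesis chiM : forall g h, chi (g * h)%g = chi g * chi h.

Let phig g := translate_chart hact g phi.

(** The default 1 is reached only off the preimage of W, where [eigen_generator] is 0 anyway. *)
Definition sheet (x : X) : gT := xget 1%g [set g | dom (phig g) x].

Lemma sheet_eq g x : dom (phig g) x -> sheet x = g.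
Proof.
have im h : dom (phig h) x -> (act h @` U) x.
  by rewrite /= dom_phi => Ux; exists (act h^-1 x)%g; rewrite ?(actKV hact).
move=> gx; rewrite /sheet; case: xgetP => [h _ hx|/(_ g)//].
apply: contrapT => /disjU hg; suff : set0 x by [].
by rewrite -hg; split; exact: im.
Qed.

Lemma preW_sheet x : W (pi x) <-> exists g, dom (phig g) x.
Proof.
rewrite -[W (pi x)]/((pi @^-1` W) x) preW; split=> [[g _ [u Uu <-]]|[g gx]].
  by exists g; apply: (dom_translate hact); rewrite dom_phi.
exists g => //; exists (act g^-1 x)%g; last exact: actKV.
by rewrite -dom_phi.
Qed.

Lemma dom_phig_act k g x : dom (phig g) x -> dom (phig (k * g)%g) (act k x).
Proof. by rewrite /= invMg (actM hact) (actVK hact). Qed.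

Lemma preW_act k x : W (pi (act k x)) <-> W (pi x).
Proof.
split=> /preW_sheet [g gx]; apply/preW_sheet.
  by exists (k^-1 * g)%g; rewrite -[x](actVK hact k); exact: dom_phig_act.
by exists (k * g)%g; exact: dom_phig_act.
Qed.

(* The chi-equivariant extension to pi^-1(W) of (dz_1 /\ ... /\ dz_n)^m on U. *)
Definition eigen_generator : preform X := fun x a =>
  if `[< [/\ W (pi x), atlas a & dom a x] >]
  then chi (sheet x) * trans_factor m a (phig (sheet x)) x else 0.

Lemma eigen_generatorE g x a : atlas a -> dom a x -> dom (phig g) x ->
  eigen_generator x a = chi g * trans_factor m a (phig g) x.
Proof.
move=> aa ax gx; rewrite /eigen_generator asboolT ?(sheet_eq gx) //.
by split=> //; apply/preW_sheet; exists g.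
Qed.

Lemma eigen_generator_pluriform : is_pluriform m (pi @^-1` W) eigen_generator.
Proof.
split.
- by move=> x a nx; rewrite /eigen_generator asboolF.
- move=> x a b /preW_sheet [g gx] aa ab ax bx.
  apply: etrans (eigen_generatorE aa ax gx) _.
  apply: etrans _ (congr1 (fun t => t * _) (esym (eigen_generatorE ab bx gx))).
  apply: etrans _ (mulrA _ _ _); apply: congr1.
  have ag := atlas_translate hact g atlas_phi.
  exact: trans_factor_comp.
(* Near a point of the sheet of g the index g is constant, so the coefficient is chi(g) times a
   power of a holomorphic Jacobian determinant. *)
- move=> a aa; apply: holomorphic_local => _ [x [/preW_sheet [g gx] ax] <-].
  have ag := atlas_translate hact g atlas_phi.
  exists (coord a @` (dom (phig g) `&` dom a)); first by exists x.
  have oV : open (coord a @` (dom (phig g) `&` dom a)).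
    exact/open_chart_img/open_dom.
  have htr := atlas_compat aa ag; rewrite /transition_holomorphic setIC in htr.
  have hJ := holomorphic_lin (chi g) oV
    (holomorphic_det_jacobian m oV htr) (@holomorphic0 _ _ _ _).
  apply: eq_holomorphic hJ => // _ [x' [gx' ax'] <-].
  rewrite coordK // addr0; apply/esym; exact: eigen_generatorE.
Qed.

(** The action of k takes the sheet of g to that of k * g and is the identity in their charts, so
    only the scalar changes, from chi(g) to chi(k) chi(g). *)
Lemma pullback_eigen_generator k :
  pullback m (act k) eigen_generator = chi k *: eigen_generator.
Proof.
apply/funext => x; apply/funext => a.
rewrite -[RHS]/(chi k * eigen_generator x a).
have [[aa ax]|nax] := pselect (atlas a /\ dom a x); last first.
  rewrite /pullback asboolF // /eigen_generator asboolF ?mulr0 //.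
  by case=> _ aa ax; apply: nax.
rewrite /pullback asboolT //.
have E : (act k \o param a) (coord a x) = act k x by rewrite /= coordK.
rewrite /pullback_coef E; set c := chart_at (act k x).
have ac : atlas c := chart_at_atlas _; have cx : dom c (act k x) := dom_chart_at _.
(* The preimage of W is invariant, so outside it both sides are 0. *)
have [/preW_sheet [g gx]|nWx] := pselect (W (pi x)); last first.
  rewrite /eigen_generator !asboolF ?mul0r ?mulr0 //.
  - by case.
  - by case=> /preW_act.
have kgx := dom_phig_act k gx; have akg := atlas_translate hact (k * g)%g atlas_phi.
have hk := act_holomorphic hact k.
have J := jacobian_map_comp hk (holomorphic_map_id X) aa ac akg I I ax cx kgx.
apply: etrans (congr1 (fun t => t * _) (eigen_generatorE ac cx kgx)) _.
apply: etrans _ (congr1 (fun t => _ * t) (esym (eigen_generatorE aa ax gx))).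
apply: etrans (esym (mulrA _ _ _)) _.
apply: etrans (congr1 (fun t => t * _) (chiM k g)) _.
apply: etrans (esym (mulrA _ _ _)) _; do 2 apply: congr1.
apply: etrans (esym (exprMn _ _ _)) _; apply: (congr1 (fun t => t ^+ m)).
apply: etrans (mulrC _ _) _; apply: etrans (esym (det_mulmx _ _)) _.
apply: etrans (congr1 determinant (esym J)) _.
congr (\det ('J _ _)); apply/funext => z /=.
by rewrite invMg (actM hact) (actVK hact).
Qed.

End EigenGenerator.

Section Vanishing.
Variables (R : realType) (n : nat) (X Y : cmanifold R n) (m : nat).
Variables (gT : finGroupType) (act : gT -> X -> X) (pi : X -> Y).
Hypothesis hact : holomorphic_action act.
Local Notation C := R[i].

(** [eigen_section] allows any function chi; a nonzero eigenform forces it to be multiplicative, as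
    the equivariance of [eigen_generator] requires. *)
Lemma eigen_section_eigenvalueM (chi : gT -> C) (s : preform X) g h :
  eigen_section act pi m chi setT s -> s != 0 -> chi (g * h)%g = chi g * chi h.
Proof.
move=> [/asboolP sP sE] s0.
pose w : pluriform X m := Pluriform sP.
have w0 : w != 0 by apply: contra_neq s0 => /(congr1 (@form_val _ _ _ _)).
apply: (eigenvalueM (canonical_rep_linear hact) (canonical_repM hact) w0) => k.
by apply: val_inj; exact: sE.
Qed.

(** Treated apart because the zero section says nothing about chi, so [eigen_generator] may fail to
    be equivariant. *)
Lemma eigen_section_vanishes0 chi y : eigen_section_vanishes act pi m chi 0 y.
Proof.
exists setT, (fun=> 0), 0; split.
- by split=> //; exact: openT.
- by move=> a aa; exact: holomorphic0.
- by [].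
- split=> [|g]; first exact: pluriform0.
  have := pullback_linear m (act g) (-1) 0 0.
  by rewrite scaler0 addr0 scaleN1r addNr => ->; rewrite scaler0.
- by move=> x a _; rewrite mul0r.
Qed.

(* Off the branch locus the eigensheaf is free over W, generated by
   eigen_generator; the value of s at x0 is that of its coefficient at y. *)
Lemma eigen_section_vanishes_at (y : Y) (x0 : X) (U : set X) (W : set Y) (sigma : R)
    (phi : chart R n X) (chi : gT -> C) (s : preform X) :
  (forall x x', pi x = pi x' <-> exists g, x' = act g x) ->
  evaluation_data act pi y x0 U W sigma phi ->
  eigen_section act pi m chi setT s -> s x0 phi = 0 ->
  eigen_section_vanishes act pi m chi s y.
Proof.
move=> orb data sS s0.
have [->|sn0] := eqVneq s 0; first exact: eigen_section_vanishes0.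
have chiM g h := eigen_section_eigenvalueM g h sS sn0.
case: data => pix0 Ux0 [oU oW _ [F' [hF' FU FW]]] preW disjU aphi dphi _ _ _.
case: sS => sP sE.
(* The function on W is the coefficient of s on the sheet U, carried down by the inverse F' of
   pi. *)
exists W, (fun y' => s (F' y') phi), (eigen_generator m pi hact W phi chi); split.
- by split=> //; rewrite -pix0; exact: (FU _ Ux0).1.
- move=> b ab.
  have imgE : W `&` dom b `&` F' @^-1` dom phi = W `&` dom b.
    apply/seteqP; split=> [y' []//|y' [Wy' by']]; split=> //.
    by rewrite /= dphi; exact: (FW _ Wy').1.
  have hc := hF'.2 b phi ab aphi; rewrite imgE in hc.
  have oV : open (coord b @` (W `&` dom b)) := @open_chart_img _ _ _ b _ oW.
  have hs := pluriform_holomorphic sP aphi.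
  (* In coordinates the function is the coefficient of s in phi composed with the expression of
     F'. *)
  have hcs : holomorphic (coord b @` (W `&` dom b))
      ((fun z => s (param phi z) phi : C^o) \o (coord phi \o F' \o param b)).
    move=> k; apply: (Cdifferentiable_comp oV _ (hc k) (hs k)).
    move=> _ [y' [Wy' by'] <-]; exists (F' y'); last by rewrite /= coordK.
    by split=> //; rewrite dphi; exact: (FW _ Wy').1.
  apply: eq_holomorphic hcs => // _ [y' [Wy' by'] <-] /=.
  by rewrite (coordK by') coordK // dphi; exact: (FW _ Wy').1.
- by rewrite -pix0 (FU _ Ux0).2.
- split; first exact: (eigen_generator_pluriform m hact aphi dphi preW disjU chi).
  exact: (pullback_eigen_generator m hact aphi dphi preW disjU chiM).
- move=> x a Wx.
  have [[aa ax]|nax] := pselect (atlas a /\ dom a x); last first.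
    rewrite (pluriform_support sP) => [|[_ aa ax]]; last exact: nax.
    have tP := eigen_generator_pluriform m hact aphi dphi preW disjU chi.
    rewrite (pluriform_support tP) ?mulr0 //.
    by case=> _ aa ax; apply: nax.
  have [g gx] := (preW_sheet hact dphi preW x).1 Wx.
  have ag := atlas_translate hact g aphi.
  (* On the sheet of g, equivariance compares s at x with s at g^-1 x in U, at the cost of the
     factor chi(g) built into the generator. *)
  have Uu : U (act g^-1 x)%g by rewrite -dphi.
  have pu : F' (pi x) = act g^-1%g x.
    rewrite -[RHS](FU _ Uu).2; congr F'; apply/orb.
    by exists g^-1%g.
  rewrite pu (eigen_generatorE m dphi preW disjU chi aa ax gx).
  rewrite (pluriform_cocycle sP _ aa ag ax gx) // mulrA; congr (_ * _).
  have du : dom phi (act g^-1 x)%g by rewrite dphi.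
  have := pullback_translate hact g sP aphi du.
  rewrite (actKV hact) => <-; rewrite sE.
  exact: mulrC.
Qed.

End Vanishing.

(** * Evaluation on a general fibre *)

Theorem proposition4p5 (R : realType) (n : nat) (X Y : cmanifold R n)
    (gT : finGroupType) (act : gT -> X -> X) (pi : X -> Y) (m : nat)
    (X_compact : compact [set: X]) (Y_compact : compact [set: Y])
    (cover : abelian_cover act pi)
    (m_ge1 : (1 <= m)%N)
    (H0_neq0 : exists w : pluriform X m, w != 0)
    (y : Y) (y_general : general_point pi m cover y)
    (x0 : X) (U : set X) (W : set Y) (sigma : R) (phi : chart R n X)
    (data : evaluation_data act pi y x0 U W sigma phi) :
  exists ev_neq0 : forall g : gT, ev act m phi g != 0,
    injective (fun g : gT => proj_point (ev_neq0 g)) <->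
    (forall h : gT, h <> 1%g ->
       exists chi chi' : gT -> R[i],
         [/\ irr_constituent (canonical_rep (m := m) cover) chi,
             irr_constituent (canonical_rep (m := m) cover) chi' &
             chi h <> chi' h]).
Proof.
pose rho := canonical_rep (m := m) cover.
have x0phi : atlas phi /\ dom phi x0.
  by case: data => _ Ux0 _ _ _ aphi -> _ _ _; split.
(* Since phi is centred at x0, evaluating at 0 reads off the coefficient at x0 of the pulled-back
   form. *)
have evE g w : ev act m phi g w = form_val (rho g w) x0 phi.
  have E : form_val (rho g w) x0 phi =
      pullback_coef m (form_val w) (act g \o param phi) (coord phi x0).
    by rewrite -[LHS]/(pullback m (act g) (form_val w) x0 phi) /pullback asboolT.
  apply: etrans _ (esym E).
  exact: (congr1 (pullback_coef m (form_val w) _) (esym (eval_center data))).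
have ev1E w : ev act m phi 1%g w = form_val w x0 phi.
  apply: etrans (evE 1%g w) _.
  exact: (congr1 (fun v : pluriform X m => form_val v x0 phi) (canonical_rep1 cover w)).
apply: injective_orbit_projective.
- exact: cover_abelian cover.
- exact: canonical_rep_linear.
- exact: canonical_rep1.
- exact: canonical_repM.
- exact: H0_neq0.
- by move=> g w; apply: etrans (evE g w) _; exact: (esym (ev1E _)).
(* As y avoids the base locus, some global eigenform does not vanish at y as a section of the
   eigensheaf; its coefficient at x0 is then nonzero. *)
move=> chi chiP; have := y_general.2 chi chiP.
move=> /existsNP [s /not_implyP [sS nvs]].
have /asboolP sP := sS.1.
exists (Pluriform sP) => [g|]; first by apply: val_inj; exact: sS.2.
apply: contra_notN nvs => /eqP s0; have {}s0 := etrans (esym (ev1E _)) s0.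
have orb := quotient_orbit (cover_quotient cover).
exact: (eigen_section_vanishes_at cover orb data sS s0).
Qed.
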